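(* Let $q\geq 0$ and let $\{r_1,\dots,r_n\}$ be a probability distribution with $r_j>0$ for all $j=1,\dots,n$. Then $$0\leq n\min_{1\leq i\leq n}\{r_i\}\left\{\ln_q\left(\frac1n\sum_{j=1}^n\frac1{r_j}\right)-\frac1n\sum_{j=1}^n\ln_q\frac1{r_j}\right\}\leq \ln_q n-H_q(r_1,\dots,r_n)$$ $$\leq n\max_{1\leq i\leq n}\{r_i\}\left\{\ln_q\left(\frac1n\sum_{j=1}^n\frac1{r_j}\right)-\frac1n\sum_{j=1}^n\ln_q\frac1{r_j}\right\}.$$
   Context: For $q\ge 0$, $q\neq 1$ and $x>0$, $\ln_q(x)=\frac{x^{1-q}-1}{1-q}$, and $\ln_1(x)=\log x$. The Tsallis entropy is $H_q(r_1,\dots,r_n)=\sum_{j=1}^n r_j\ln_q\frac1{r_j}$ (Shannon entropy for $q=1$). *)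

(* Defs.v *)
From mathcomp Require Import all_boot all_order all_algebra.
From mathcomp Require Import all_classical all_reals all_analysis.
Set Implicit Arguments.
Unset Strict Implicit.
Unset Printing Implicit Defensive.
Import Order.TTheory GRing.Theory Num.Theory.
Local Open Scope ring_scope.

(* Only meaningful for 0 < x: [powR] and [ln] are totalized elsewhere. *)
Definition lnq {R : realType} (q x : R) : R :=
  if q == 1 then ln x else (x `^ (1 - q) - 1) / (1 - q).

Definition tsallis_entropy {R : realType} (q : R) {n : nat} (r : 'I_n -> R) : R :=
  \sum_(j < n) r j * lnq q (1 / r j).

Definition positive_distribution {R : realType} {n : nat} (r : 'I_n -> R) : Prop :=
  (forall j, 0 < r j) /\ \sum_(j < n) r j = 1.

(* The unit of each iterated operator is a member of the family, so these are
   the actual extrema; a nonempty index type is needed for that. *)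
Definition family_min {R : realType} {n : nat} (r : 'I_n.+1 -> R) : R :=
  \big[Num.min/r ord0]_(i < n.+1) r i.

Definition family_max {R : realType} {n : nat} (r : 'I_n.+1 -> R) : R :=
  \big[Num.max/r ord0]_(i < n.+1) r i.

(* Main.v *)
Require Import Defs.
From mathcomp Require Import all_boot all_order all_algebra.
From mathcomp Require Import all_classical all_reals all_analysis.
From mathcomp Require Import ring lra.
Set Implicit Arguments.
Unset Strict Implicit.
Unset Printing Implicit Defensive.
Import Order.TTheory GRing.Theory Num.Theory.
Local Open Scope ring_scope.

(** [lnq q] is concave, so it lies below each of its tangents; all three
    inequalities are Jensen's inequality for suitable weights at the points
    [x_j = 1 / r_j], with uniform mean [A] and [r]-weighted mean [n].
    With [mu = min r], [n] is the mean of [A] with weight [n * mu] and of the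
    [x_j] with weights [r_j - mu]; with [M = max r], [A] is the mean of [n] with
    weight [1] and of the [x_j] with weights [M - r_j], of total weight [n * M]. *)

Lemma ln_le_sub1 (R : realType) (x : R) : 0 < x -> ln x <= x - 1.
Proof.
move=> x0; have := @le_ln1Dx R (x - 1).
by rewrite subrKC; apply; lra.
Qed.

(** Weighted AM-GM for [x] and [1] with weights [a] and [1 - a], whose arithmetic mean is [u]:
    bounding [ln] at [x / u] and [1 / u] by its tangent at 1 gives [a * ln x <= ln u]. *)
Lemma powR_le_bernoulli (R : realType) (a x : R) :
  0 <= a -> a <= 1 -> 0 < x -> x `^ a <= 1 + a * (x - 1).
Proof.
move=> a0 a1 x0; set u := 1 + a * (x - 1).
have u0 : 0 < u.
  (* Since [u = (1 - a) + a * x], the first term is positive unless [a = 1], where [u = x]. *)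
  rewrite /u; have [->|a_neq1] := eqVneq a 1; first by lra.
  have a_lt1 : a < 1 by rewrite lt_neqAle a_neq1.
  have := mulr_ge0 a0 (ltW x0); lra.
rewrite /powR gt_eqF // -[leRHS]lnK ?posrE // ler_expR.
have lnxu : ln x - ln u <= x / u - 1.
  by rewrite -ln_div ?posrE // ln_le_sub1 // divr_gt0.
have lnVu : - ln u <= u^-1 - 1.
  by rewrite -lnV ?posrE // ln_le_sub1 // invr_gt0.
have tangent0 : a * (x / u - 1) + (1 - a) * (u^-1 - 1) = 0.
  have : u * u^-1 = 1 by rewrite divff // gt_eqF.
  by rewrite {1}/u; lra.
have := ler_wpM2l a0 lnxu.
have a1' : 0 <= 1 - a by lra.
have := ler_wpM2l a1' lnVu.
lra.
Qed.

Lemma powR_ge_bernoulli (R : realType) (a x : R) :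
  a <= 0 -> 0 < x -> 1 + a * (x - 1) <= x `^ a.
Proof.
move=> a0 x0; rewrite /powR gt_eqF //.
apply: le_trans (expR_ge1Dx _).
by rewrite lerD2l ler_wnM2l // ln_le_sub1.
Qed.

(** The tangent of [lnq q] at 1. The sign of [1 - q] selects the Bernoulli inequality and the
    direction of the division; [0 <= q] keeps the exponent at most 1. *)
Lemma lnq_le_sub1 (R : realType) (q x : R) :
  0 <= q -> 0 < x -> lnq q x <= x - 1.
Proof.
move=> q0 x0; rewrite /lnq; case: eqP => [_|/eqP q1]; first exact: ln_le_sub1.
have [q_lt1|q_ge1] := ltP q 1.
  have a0 : 0 < 1 - q by lra.
  rewrite ler_pdivrMr //.
  have := @powR_le_bernoulli R (1 - q) x; lra.
have a0 : 1 - q < 0 by rewrite subr_lt0 lt_neqAle eq_sym q1.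
rewrite ler_ndivrMr //.
have := @powR_ge_bernoulli R (1 - q) x (ltW a0) x0; lra.
Qed.

Lemma lnqM (R : realType) (q x y : R) : 0 < x -> 0 < y ->
  lnq q (x * y) = lnq q x + x `^ (1 - q) * lnq q y.
Proof.
move=> x0 y0; rewrite /lnq; case: eqP => [->|/eqP q1].
  by rewrite subrr powRr0 mul1r lnM.
rewrite powRM ?ltW //.
have a0 : 1 - q != 0 by rewrite subr_eq0 eq_sym.
by field.
Qed.

(** Writing [y] as [x * (y / x)], [lnqM] transports the tangent at 1 to [x]; the slope is the
    derivative, x to the power -q. *)
Lemma lnq_tangent (R : realType) (q x y : R) : 0 <= q -> 0 < x -> 0 < y ->
  lnq q y <= lnq q x + x `^ (1 - q) / x * (y - x).
Proof.
move=> q0 x0 y0; have x_neq0 : x != 0 by rewrite gt_eqF.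
rewrite -[y in leLHS](divfK x_neq0) mulrC lnqM ?divr_gt0 // lerD2l.
rewrite -mulrA ler_wpM2l ?powR_ge0 //.
have -> : x^-1 * (y - x) = y / x - 1 by field.
by rewrite lnq_le_sub1 // divr_gt0.
Qed.

(** Unnormalized weights avoid dividing by the total; the separate pair [c], [z] adjoins one point
    to the family. *)
Lemma lnq_jensen (R : realType) (I : finType) (q c z X : R) (w x : I -> R) :
  0 <= q -> 0 <= c -> 0 < z -> 0 < X ->
  (forall j, 0 <= w j) -> (forall j, 0 < x j) ->
  c * z + \sum_j w j * x j = (c + \sum_j w j) * X ->
  c * lnq q z + \sum_j w j * lnq q (x j) <= (c + \sum_j w j) * lnq q X.
Proof.
move=> q0 c0 z0 X0 w0 x0 mean.
set s := X `^ (1 - q) / X.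
have tgt y : 0 < y -> lnq q y <= lnq q X - s * X + s * y.
  by move=> y0; have := lnq_tangent q0 X0 y0; rewrite -/s; lra.
have le_c := ler_wpM2l c0 (tgt z z0).
have le_w : \sum_j w j * lnq q (x j) <=
    (\sum_j w j) * (lnq q X - s * X) + s * \sum_j w j * x j.
  rewrite mulr_suml mulr_sumr -big_split /=; apply: ler_sum => j _.
  have := ler_wpM2l (w0 j) (tgt (x j) (x0 j)); lra.
(* Scaled by the slope, the mean condition cancels the linear parts of the tangents at [X]. *)
have := congr1 ( *%R s) mean.
lra.
Qed.

Theorem corollary3p3 (R : realType) (q : R) (m : nat) (r : 'I_m.+1 -> R)
    (hq : 0 <= q) (hr : positive_distribution r) :
  let n : R := m.+1%:R in
  let gap : R := lnq q (1 / n * \sum_(j < m.+1) 1 / r j)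
                 - 1 / n * \sum_(j < m.+1) lnq q (1 / r j) in
  [/\ 0 <= n * family_min r * gap,
      n * family_min r * gap <= lnq q n - tsallis_entropy q r
    & lnq q n - tsallis_entropy q r <= n * family_max r * gap].
Proof.
move=> n gap; case: hr => r0 r1.
have n0 : 0 < n by rewrite ltr0n.
set F : 'I_m.+1 -> R := fun j => lnq q (1 / r j).
set A := 1 / n * \sum_(j < m.+1) 1 / r j.
have x0 j : 0 < 1 / r j by rewrite divr_gt0.
have rx j : r j * (1 / r j) = 1 by rewrite mul1r divff // gt_eqF.
have sum_rx : \sum_j r j * (1 / r j) = n.
  by rewrite (eq_bigr (fun=> 1) (fun j _ => rx j)) sumr_const card_ord.
have sum_c (c : R) : \sum_(j < m.+1) c = n * c.
  by rewrite sumr_const card_ord -mulr_natl.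
have sum_x : \sum_(j < m.+1) 1 / r j = n * A.
  by rewrite /A mulrA mul1r divff ?gt_eqF // mul1r.
have A0 : 0 < A.
  rewrite -(pmulr_rgt0 A n0) -sum_x big_ord_recl ltr_pwDl //.
  by apply: sumr_ge0 => j _; apply: ltW.
have mu0 : 0 <= family_min r by apply: le_bigmin => // [|j _]; apply: ltW.
have mu_le j : family_min r <= r j by apply: bigmin_le.
have le_M j : r j <= family_max r by apply: le_bigmax.
have gapE : n * gap = n * lnq q A - \sum_j F j.
  by rewrite /gap -/A mulrBr mul1r mulVKf ?gt_eqF.
have scaled c : n * c * gap = c * n * lnq q A - c * \sum_j F j.
  by rewrite -mulrA mulrCA gapE mulrBr mulrA.
have sumB c (f : 'I_m.+1 -> R) :
    \sum_j (r j - c) * f j = \sum_j r j * f j - c * \sum_j f j.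
  by rewrite mulr_sumr -sumrB; apply: eq_bigr => j _; rewrite mulrBl.
have sumB1 c : \sum_j (r j - c) = 1 - n * c by rewrite sumrB r1 sum_c.
rewrite !scaled /tsallis_entropy -/F; split.
(* The extra point has weight 0, so its value 1 is an arbitrary positive number. *)
- have := @lnq_jensen R _ q 0 1 A (fun=> 1) _ hq (lexx _) ltr01 A0
    (fun=> ler01) x0.
  have sum1 (f : 'I_m.+1 -> R) : \sum_j 1 * f j = \sum_j f j.
    by apply: eq_bigr => j _; rewrite mul1r.
  rewrite !mul0r !add0r sum_c mulr1 (sum1 F) (sum1 (fun j => 1 / r j)) sum_x => /(_ erefl) le_A.
  by rewrite -mulrA -mulrBr mulr_ge0 // subr_ge0.
- have w0 j : 0 <= r j - family_min r by rewrite subr_ge0.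
  (* The total weight is 1, and the two multiples of [A] cancel in the mean, leaving [n]. *)
  have := @lnq_jensen R _ q (n * family_min r) A n _ _ hq
    (mulr_ge0 (ltW n0) mu0) A0 n0 w0 x0.
  rewrite !sumB sumB1 sum_rx sum_x -/F.
  move=> H; have := H ltac:(ring); lra.
- have w0 j : 0 <= family_max r - r j by rewrite subr_ge0.
  (* Here the point [n] cancels the sum of [r j * (1 / r j)], leaving [n * family_max r * A]. *)
  have := @lnq_jensen R _ q 1 n A _ _ hq ler01 n0 A0 w0 x0.
  have sumBN (f : 'I_m.+1 -> R) : \sum_j (family_max r - r j) * f j =
      family_max r * \sum_j f j - \sum_j r j * f j.
    by rewrite mulr_sumr -sumrB; apply: eq_bigr => j _; rewrite mulrBl.
  rewrite !sumBN sumrB r1 sum_c sum_rx sum_x.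
  move=> H; have := H ltac:(ring); lra.
Qed.
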